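(* Let $C\ge 2$, let $p$ and $q_t=\mathrm{softmax}(f^t)$ be strictly positive probability distributions on $\{1,\dots,C\}$, and let $\eta>0$. Let $\mathsf{LogR}^{\mathcal F}_t$, $\mathsf{N}^{\mathcal F}_t$ (resp. $\mathsf{LogR}^{\mathcal R}_t$, $\mathsf{N}^{\mathcal R}_t$) be the log mass ratio and normalization factor of one gradient descent step on the logits with learning rate $\eta$ for the loss $\mathbb{D}_{\mathrm{KL}}(p\|q)$ (FKLD) (resp. the loss $\mathbb{D}_{\mathrm{KL}}(q\|p)$ (RKLD)). Then for every class $y$: $$\big|\mathsf{LogR}^{\mathcal F}_t(y)\big|\le \eta\,\big|p(y)-q_t(y)\big|+\big|\mathsf{N}^{\mathcal F}_t(y)\big|,$$ $$\big|\mathsf{LogR}^{\mathcal R}_t(y)\big|\le \eta\, q_t(y)\Big(\big|\log p(y)-\log q_t(y)\big|+\sum_{k} q_t(k)\,\big|\log p(k)-\log q_t(k)\big|\Big)+\big|\mathsf{N}^{\mathcal R}_t(y)\big|,$$ where $\mathsf{N}^{\mathcal F}_t(y)$ and $\mathsf{N}^{\mathcal R}_t(y)$ are independent of $y$ and vanish when $p=q_t$.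
   Context: $p$ is a fixed teacher distribution on $C$ classes. The student distribution at step $t$ is $q_t(y)=\exp(f^t_y)/\sum_k\exp(f^t_k)$ for a logit vector $f^t\in\mathbb{R}^C$. For a loss $\ell$, viewed as a function of the logits $f$ through $q=\mathrm{softmax}(f)$, one gradient descent step with learning rate $\eta$ is $f^{t+1}_y=f^t_y-\eta\,\nabla_{f^t_y}\ell$, where $\nabla_{f^t_y}\ell$ is the partial derivative of $\ell$ with respect to $f_y$ at $f^t$, and $q_{t+1}=\mathrm{softmax}(f^{t+1})$. The log mass ratio is $\mathsf{LogR}_t(y)=\log\big(q_{t+1}(y)/q_t(y)\big)$, and the normalization factor is defined by $\mathsf{LogR}_t(y)=-\eta\,\nabla_{f^t_y}\ell+\mathsf{N}_t(y)$. Here $\mathbb{D}_{\mathrm{KL}}(p\|q)=\sum_k p(k)\log\frac{p(k)}{q(k)}$ and $\mathbb{D}_{\mathrm{KL}}(q\|p)=\sum_k q(k)\log\frac{q(k)}{p(k)}$. *)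

(* Defs.v *)
From HB Require Import structures.
From mathcomp Require Import all_boot all_order all_algebra.
From mathcomp Require Import all_classical all_reals all_analysis.

Set Implicit Arguments.
Unset Strict Implicit.
Unset Printing Implicit Defensive.

Import Order.TTheory GRing.Theory Num.Theory.
Import numFieldNormedType.Exports.

Local Open Scope ring_scope.

Definition positive_distribution (R : realType) (C : nat) (p : 'I_C -> R) :=
  (forall y, 0 < p y) /\ \sum_(y < C) p y = 1.

Definition softmax (R : realType) (C : nat) (f : 'rV[R]_C) (y : 'I_C) : R :=
  expR (f 0 y) / \sum_(k < C) expR (f 0 k).

Definition KL (R : realType) (C : nat) (p q : 'I_C -> R) : R :=
  \sum_(k < C) p k * ln (p k / q k).

(* Forward KL: the teacher p is the first argument of the divergence. *)
Definition FKLD (R : realType) (C : nat) (p : 'I_C -> R) (f : 'rV[R]_C) : R :=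
  KL p (softmax f).

(* Reverse KL: the student is the first argument of the divergence. *)
Definition RKLD (R : realType) (C : nat) (p : 'I_C -> R) (f : 'rV[R]_C) : R :=
  KL (softmax f) p.

(* The partial derivative with respect to the y-th logit is the directional
   derivative along the y-th vector of the standard basis. *)
Definition gradient (R : realType) (C : nat) (loss : 'rV[R]_C -> R)
    (f : 'rV[R]_C) : 'rV[R]_C :=
  \row_(y < C) 'D_(delta_mx 0 y) loss f.

Definition gd_step (R : realType) (C : nat) (eta : R) (loss : 'rV[R]_C -> R)
    (f : 'rV[R]_C) : 'rV[R]_C :=
  f - eta *: gradient loss f.

Definition LogR (R : realType) (C : nat) (eta : R) (loss : 'rV[R]_C -> R)
    (f : 'rV[R]_C) (y : 'I_C) : R :=
  ln (softmax (gd_step eta loss f) y / softmax f y).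

(* The unique solution N of LogR y = - eta * gradient y + N. *)
Definition normalization (R : realType) (C : nat) (eta : R)
    (loss : 'rV[R]_C -> R) (f : 'rV[R]_C) (y : 'I_C) : R :=
  LogR eta loss f y + eta * gradient loss f 0 y.

(* Main.v *)
(** Writing [softmax f y = exp (f y - L f)] with [L] the log-sum-exp, a gradient
    step changes [ln q y] by [- eta * gradient y + (L f - L f')], so for any loss
    the normalization factor is the difference of two log-sum-exps, which does
    not involve [y]. The two bounds are then the triangle inequality applied to
    the gradients [q y - p y] (forward) and
    [q y * (ln (q y / p y) - \sum_k q k * ln (q k / p k))] (reverse), both of
    which vanish when [p = q]. *)
Require Import Defs.
From HB Require Import structures.
From mathcomp Require Import all_boot all_order all_algebra.
From mathcomp Require Import all_classical all_reals all_analysis.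
From mathcomp Require Import ring.

Import Order.TTheory GRing.Theory Num.Theory.
Import numFieldNormedType.Exports.

Local Open Scope ring_scope.

Definition logsumexp {R : realType} {C : nat} (f : 'rV[R]_C) : R :=
  ln (\sum_(k < C) expR (f 0 k)).

Section Softmax.
Context {R : realType} {C : nat}.
Implicit Types (f : 'rV[R]_C) (y k : 'I_C).

(** The class [y] serves as a witness that the sum is nonempty: its term is positive and the others
    are nonnegative. *)
Lemma sum_expR_gt0 f y : 0 < \sum_(k < C) expR (f 0 k).
Proof.
rewrite (bigD1 y) //= ltr_pwDl ?expR_gt0//.
by apply: sumr_ge0 => k _; exact: expR_ge0.
Qed.

Lemma softmax_gt0 f y : 0 < softmax f y.
Proof. by rewrite divr_gt0 ?expR_gt0 ?(sum_expR_gt0 _ y). Qed.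

Lemma sum_softmax f y : \sum_(k < C) softmax f k = 1.
Proof. by rewrite -mulr_suml divff// gt_eqF// (sum_expR_gt0 f y). Qed.

Lemma ln_softmax f y : ln (softmax f y) = f 0 y - logsumexp f.
Proof. by rewrite ln_div ?expRK// posrE ?expR_gt0 ?(sum_expR_gt0 _ y). Qed.

Lemma normalizationE (eta : R) (loss : 'rV[R]_C -> R) f y :
  normalization eta loss f y
  = logsumexp f - logsumexp (gd_step eta loss f).
Proof.
rewrite /normalization /LogR ln_div ?posrE ?softmax_gt0// !ln_softmax.
by rewrite {1}/gd_step !mxE; ring.
Qed.

Lemma normLogR_le (eta : R) (loss : 'rV[R]_C -> R) f y : 0 < eta ->
  `|LogR eta loss f y|
  <= eta * `|gradient loss f 0 y| + `|normalization eta loss f y|.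
Proof.
move=> eta_gt0.
have -> : LogR eta loss f y
    = normalization eta loss f y - eta * gradient loss f 0 y.
  by rewrite /normalization addrK.
by rewrite [leRHS]addrC (le_trans (ler_normB _ _))// normrM (gtr0_norm eta_gt0).
Qed.

(** At a critical point the gradient step stays at [f], so the two log-sum-exps cancel. *)
Lemma normalization_critical (eta : R) (loss : 'rV[R]_C -> R) f y :
  gradient loss f = 0 -> normalization eta loss f y = 0.
Proof.
by move=> g0; rewrite normalizationE /gd_step g0 scaler0 subr0 subrr.
Qed.

End Softmax.

(* Reduces to a real variable, where the chain rule [is_derive1_comp] applies. *)
Lemma derive_line {R : realType} {V W : normedModType R} (g : V -> W) (x v : V) :
  'D_v g x = 'D_1 (fun h : R => g (h *: v + x)) 0.
Proof.
rewrite /derive.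
set u := (X in (X @ _)%classic); set w := (X in _ = lim (X @ _)%classic).
(* The two difference quotients agree as functions of [h], hence so do their limits, whether or not
   these converge. *)
suff -> : u = w by [].
apply/funext => h; rewrite /u /w /=.
by rewrite addr0 scale0r add0r [h *: 1]mulr1.
Qed.

Section Gradient.
Context {R : realType} {C : nat} (f : 'rV[R]_C) (y : 'I_C).

Let line (h : R) : 'rV[R]_C := h *: delta_mx 0 y + f.

Let line0 : line 0 = f. Proof. by rewrite /line scale0r add0r. Qed.

Let is_derive_logit k : is_derive (0 : R) 1 (fun h => line h 0 k) (k == y)%:R.
Proof.
have -> : (fun h => line h 0 k) = ((k == y)%:R \*: id) + cst (f 0 k).
  by apply/funext => h; rewrite /line !mxE /= fctE /= mulrC.
by apply: is_derive_eq; rewrite addr0 [_ *: 1]mulr1.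
Qed.

(** The chain rule gives the reciprocal of the sum times the derivative of the sum, in which only
    the term [k = y] moves. *)
Let is_derive_logsumexp :
  is_derive (0 : R) 1 (fun h => logsumexp (line h)) (softmax f y).
Proof.
have dsum : is_derive (0 : R) 1 (\sum_(k < C) (expR \o (fun h => line h 0 k)))
    (\sum_(k < C) expR (line 0 0 k) * (k == y)%:R).
  by apply: is_derive_sum => k; exact: is_derive1_comp.
have -> : (fun h => logsumexp (line h))
    = @ln R \o \sum_(k < C) (expR \o (fun h => line h 0 k)).
  by apply/funext => h; rewrite /logsumexp /= fct_sumE.
apply: is_derive_eq.
  apply: is_derive1_comp; apply: is_derive1_ln.
  by rewrite fct_sumE (sum_expR_gt0 _ y).
rewrite fct_sumE /= line0 mulrC (bigD1 y) //= eqxx mulr1 big1 ?addr0//.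
by move=> k /negbTE ->; rewrite mulr0.
Qed.

Let is_derive_ln_softmax k :
  is_derive (0 : R) 1 (fun h => ln (softmax (line h) k))
    ((k == y)%:R - softmax f y).
Proof.
under eq_fun do rewrite ln_softmax.
exact: is_deriveB.
Qed.

(** Logarithmic differentiation: [softmax] is the exponential of its logarithm, whose derivative is
    already known. *)
Let is_derive_softmax k :
  is_derive (0 : R) 1 (fun h => softmax (line h) k)
    (softmax f k * ((k == y)%:R - softmax f y)).
Proof.
have -> : (fun h => softmax (line h) k)
    = expR \o (fun h => ln (softmax (line h) k)).
  by apply/funext => h /=; rewrite lnK// posrE softmax_gt0.
apply: is_derive_eq; first exact: is_derive1_comp.
by rewrite /= line0 lnK// posrE softmax_gt0.
Qed.

(** Only the cross-entropy part varies with the logits. Its terms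
    [p k * (softmax f y - (k == y)%:R)] sum to the claim because [p] has total mass 1. *)
Lemma gradient_FKLD (p : 'I_C -> R) : positive_distribution p ->
  gradient (FKLD p) f 0 y = softmax f y - p y.
Proof.
move=> [p_gt0 sump]; rewrite mxE derive_line.
have -> : (fun h => FKLD p (h *: delta_mx 0 y + f))
    = \sum_(k < C) (p k \*: (cst (ln (p k)) - fun h => ln (softmax (line h) k))).
  apply/funext => h; rewrite /FKLD /KL fct_sumE; apply: eq_bigr => k _.
  by rewrite ln_div ?posrE ?softmax_gt0.
(* The value of the derivative is left open and filled in by the differentiation rules. *)
apply: etrans.
  apply: derive_val; apply: is_derive_sum => k.
  by apply: is_deriveZ; apply: is_deriveB; exact: is_derive_ln_softmax.
under eq_bigr do rewrite sub0r opprB [_ *: _]mulrBr.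
rewrite big_split /= -mulr_suml sump mul1r; congr (_ + _).
rewrite sumrN (bigD1 y) //= eqxx mulr1 big1 ?addr0//.
by move=> k /negbTE ->; rewrite mulr0.
Qed.

Lemma gradient_RKLD (p : 'I_C -> R) : (forall k, 0 < p k) ->
  gradient (RKLD p) f 0 y
  = softmax f y * (ln (softmax f y) - ln (p y)
      - \sum_(k < C) softmax f k * (ln (softmax f k) - ln (p k))).
Proof.
move=> p_gt0; rewrite mxE derive_line.
have -> : (fun h => RKLD p (h *: delta_mx 0 y + f))
    = \sum_(k < C) ((fun h => softmax (line h) k)
        * ((fun h => ln (softmax (line h) k)) - cst (ln (p k)))).
  apply/funext => h; rewrite /RKLD /KL fct_sumE; apply: eq_bigr => k _.
  by rewrite ln_div ?posrE ?softmax_gt0.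
apply: etrans.
  apply: derive_val; apply: is_derive_sum => k.
  apply: is_deriveM; first exact: is_derive_softmax.
  by apply: is_deriveB; exact: is_derive_ln_softmax.
rewrite /= line0.
pose q := softmax f; pose r k := ln (q k) - ln (p k).
(* The [+ 1] comes from differentiating the logarithm factor. After summation it contributes [q y],
   which cancels against [q y * \sum_k q k] since [q] has mass 1. *)
transitivity (\sum_(k < C) (q k * (r k + 1) * (k == y)%:R
    - (q y * (q k * r k) + q y * q k))).
  by apply: eq_bigr => k _; rewrite /= !fctE /= line0 /r /q /GRing.scale/=; ring.
rewrite sumrB big_split /= -!mulr_sumr (sum_softmax f y).
rewrite (bigD1 y) //= eqxx big1; last by move=> k /negbTE ->; rewrite mulr0.
by rewrite /r /q mulr1n; ring.
Qed.

End Gradient.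

Theorem proposition3p1 (R : realType) (C : nat) (hC : (2 <= C)%N)
    (p : 'I_C -> R) (hp : positive_distribution p)
    (f : 'rV[R]_C) (eta : R) (heta : 0 < eta) :
  let q := softmax f in
  let LogRF := LogR eta (FKLD p) f in
  let NF := normalization eta (FKLD p) f in
  let LogRR := LogR eta (RKLD p) f in
  let NR := normalization eta (RKLD p) f in
  (forall y : 'I_C, `|LogRF y| <= eta * `|p y - q y| + `|NF y|) /\
  (forall y : 'I_C,
     `|LogRR y| <=
       eta * q y * (`|ln (p y) - ln (q y)|
                    + \sum_(k < C) q k * `|ln (p k) - ln (q k)|)
       + `|NR y|) /\
  (forall y y' : 'I_C, NF y = NF y' /\ NR y = NR y') /\
  (p =1 q -> forall y : 'I_C, NF y = 0 /\ NR y = 0).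
Proof.
move=> q LogRF NF LogRR NR.
have q_gt0 k : 0 < q k := softmax_gt0 f k.
split; [|split; [|split]].
- move=> y; apply: le_trans (normLogR_le _ _ _ _ heta) _.
  by rewrite (gradient_FKLD f y p hp) distrC.
- move=> y; apply: le_trans (normLogR_le _ _ _ _ heta) _.
  (* The normalization term and the positive factors [eta] and [q y] are cancelled, leaving the
     triangle inequality for the log-ratio at [y] minus its mean under [q]. *)
  rewrite lerD2r -mulrA ler_pM2l// (gradient_RKLD f y p hp.1) normrM.
  rewrite (gtr0_norm (q_gt0 y)) ler_pM2l//.
  apply: le_trans (ler_normB _ _) _; rewrite distrC lerD2l.
  apply: le_trans (ler_norm_sum _ _ _) _; apply: ler_sum => k _.
  by rewrite normrM (gtr0_norm (q_gt0 k)) distrC.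
- by move=> y y'; rewrite /NF /NR !normalizationE.
(* With [p = q], every coordinate of both gradients vanishes: the mass differences in the forward
   case, all log-ratios in the reverse case. *)
- move=> pq y; split; apply: normalization_critical; apply/rowP => k.
    by rewrite (gradient_FKLD f k p hp) pq subrr mxE.
  rewrite (gradient_RKLD f k p hp.1) pq subrr sub0r big1 ?oppr0 ?mulr0 ?mxE//.
  by move=> j _; rewrite pq subrr mulr0.
Qed.
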